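(* Let $\mu$ be a Borel probability measure on $\mathbb{R}^d$. Then $$\dim_{qA}\mu\geq\sup\{\overline{\dim}_{\mathrm{loc}}\,\mu(x):x\in\operatorname{supp}\mu\}.$$
   Context: $B(x,r)$ denotes the ball of centre $x$ and radius $r$. The upper local dimension of $\mu$ at $x\in\operatorname{supp}\mu$ is $\overline{\dim}_{\mathrm{loc}}\,\mu(x)=\limsup_{r\to0}\frac{\log\mu(B(x,r))}{\log r}$. For $\delta\geq0$ let $H(\delta)$ be the infimum of all $s$ for which there exist $C_1,C_2>0$ such that for all $0<r\leq R^{1+\delta}\leq R\leq C_1$, $$\sup_{x\in\operatorname{supp}\mu}\frac{\mu(B(x,R))}{\mu(B(x,r))}\leq C_2\left(\frac Rr\right)^s .$$ The quasi-Assouad dimension of $\mu$ is $\dim_{qA}\mu=\lim_{\delta\to0}H(\delta)\in[0,\infty]$. *)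

(* Defs.v *)
From HB Require Import structures.
From mathcomp Require Import all_boot all_order all_algebra.
From mathcomp Require Import all_classical all_reals all_analysis.
Set Implicit Arguments.
Unset Strict Implicit.
Unset Printing Implicit Defensive.
Import Order.TTheory GRing.Theory Num.Theory.
Import numFieldNormedType.Exports.
Local Open Scope classical_set_scope.
Local Open Scope ring_scope.

(* The library norm on 'rV[R]_d is the sup norm; it induces the usual topology
   of R^d, but balls are taken here for the Euclidean norm. *)
Definition enorm (R : realType) (d : nat) (x : 'rV[R]_d) : R :=
  Num.sqrt (\sum_(i < d) x ord0 i ^+ 2).

(* Balls are open. Closed balls would give the same local dimensions and the
   same H(delta), since open B(x,r) `<=` closed B(x,r) `<=` open B(x,2r). *)
Definition eball (R : realType) (d : nat) (x : 'rV[R]_d) (r : R)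
    : set 'rV[R]_d :=
  [set y | enorm (y - x) < r].

Definition borelRd (R : realType) (d : nat) : measurableType _ :=
  g_sigma_algebraType (@open 'rV[R]_d).

Definition supp (R : realType) (d : nat) (mu : probability (borelRd R d) R)
    : set 'rV[R]_d :=
  [set x | forall U : set 'rV[R]_d, open U -> U x -> (0 < mu U)%E].

Definition upper_loc_dim (R : realType) (d : nat)
    (mu : probability (borelRd R d) R) (x : 'rV[R]_d) : \bar R :=
  limf_esup (fun r : R => (ln (fine (mu (eball x r))) / ln r)%:E) 0^'+.

Definition qA_exponent (R : realType) (d : nat)
    (mu : probability (borelRd R d) R) (delta s : R) : Prop :=
  exists C1 C2 : R, [/\ 0 < C1, 0 < C2 &
    forall r r' : R,
      0 < r -> r <= r' `^ (1 + delta) -> r' `^ (1 + delta) <= r' -> r' <= C1 ->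
      (ereal_sup [set mu (eball x r') / mu (eball x r) | x in supp mu]
        <= (C2 * (r' / r) `^ s)%:E)%E].

Definition qA_H (R : realType) (d : nat)
    (mu : probability (borelRd R d) R) (delta : R) : \bar R :=
  ereal_inf [set s%:E | s in qA_exponent mu delta].

(* delta ranges over [0, +oo[, so the limit as delta -> 0 is from the right. *)
Definition quasi_assouad_dim (R : realType) (d : nat)
    (mu : probability (borelRd R d) R) : \bar R :=
  lim (qA_H mu delta @[delta --> 0^'+]).

(* Main.v *)
Require Import Defs.
From mathcomp Require Import all_boot all_order all_algebra.
From mathcomp Require Import all_classical all_reals all_analysis.
Set Implicit Arguments.
Unset Strict Implicit.
Unset Printing Implicit Defensive.
Import Order.TTheory GRing.Theory Num.Theory.
Import numFieldNormedType.Exports.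
Local Open Scope classical_set_scope.
Local Open Scope ring_scope.

(** At a point [x] of the support, fix the outer radius [R] in the inequality
    defining [H(delta)] and let [r] tend to [0]: it becomes
    [mu (B(x,r)) >= c * r^s] with [c > 0] independent of [r], so the upper local
    dimension at [x] is at most [s]. Hence it is at most [H(delta)] for every
    [delta > 0], and [H] is nonincreasing on [[0, +oo[], so the limit at [0]
    exists and inherits the bound. *)

(** Links the Euclidean norm to the sup norm topology of ['rV[R]_d], so that Euclidean balls are
    open, hence Borel. *)
Lemma enorm_sub_continuous (R : realType) (d : nat) (x : 'rV[R]_d) :
  continuous (fun y : 'rV[R]_d => enorm (y - x)).
Proof.
move=> y; apply: (@continuous_comp _ _ _
  (fun z : 'rV[R]_d => \sum_(i < d) (z - x) ord0 i ^+ 2) Num.sqrt).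
  apply: continuous_big => [|i _ z]; first exact: add_continuous.
  under [X in continuous_at _ X]eq_fun do rewrite !mxE.
  apply: (@continuous_comp _ _ _
    (fun w : 'rV[R]_d => w ord0 i) (fun t => (t - x ord0 i) ^+ 2)).
    exact: coord_continuous.
  apply: (@continuous_comp _ _ _ (fun t => t - x ord0 i) (fun t => t ^+ 2)).
    by apply: cvgB; [exact: cvg_id|exact: cvg_cst].
  exact: exprn_continuous.
exact: sqrt_continuous.
Qed.

Lemma open_eball (R : realType) (d : nat) (x : 'rV[R]_d) (r : R) :
  open (eball x r).
Proof.
rewrite (_ : eball x r = (fun y => enorm (y - x)) @^-1` [set t | t < r])//.
apply: open_comp; last exact: open_lt.
by move=> y _; exact: enorm_sub_continuous.
Qed.

Lemma eball_center (R : realType) (d : nat) (x : 'rV[R]_d) (r : R) :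
  0 < r -> eball x r x.
Proof.
move=> r0; rewrite /eball /= /enorm subrr big1 ?sqrtr0// => i _.
by rewrite mxE expr0n.
Qed.

Lemma measure_eball_fin_num (R : realType) (d : nat)
    (mu : probability (borelRd R d) R) (x : 'rV[R]_d) (r : R) :
  mu (eball x r) \is a fin_num.
Proof.
by apply: fin_num_measure; apply: sub_sigma_algebra; exact: open_eball.
Qed.

Lemma measure_eball_gt0 (R : realType) (d : nat)
    (mu : probability (borelRd R d) R) (x : 'rV[R]_d) (r : R) :
  supp mu x -> 0 < r -> 0 < fine (mu (eball x r)).
Proof.
move=> xmu r0; rewrite -lte_fin fineK ?measure_eball_fin_num//.
by apply: xmu; [exact: open_eball|exact: eball_center].
Qed.

(** Take logarithms and divide by [ln r < 0], which reverses the inequality; the leftover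
    [ln c / ln r] tends to [0]. *)
Lemma limf_esup_ln_ratio_le (R : realType) (m : R -> R) (c s : R) :
  0 < c -> (\forall r \near 0^'+, c * r `^ s <= m r) ->
  (limf_esup (fun r => (ln (m r) / ln r)%:E) 0^'+ <= s%:E)%E.
Proof.
move=> c0 cm; apply/lee_addgt0Pr => e e0.
(* [limf_esup] is an infimum, over the sets of the filter, of suprema; one set [P] of the filter
   with supremum at most [s + e] suffices. *)
pose P := [set r : R | ln (m r) / ln r <= s + e].
suff nP : 0^'+ P.
  apply: ge_ereal_inf; exists (ereal_sup [set (ln (m r) / ln r)%:E | r in P]).
    by exists P.
  by apply: ge_ereal_sup => _ [r Pr <-]; rewrite -EFinD lee_fin.
rewrite /P; near=> r => /=.
have r0 : 0 < r by [].
have lnr0 : ln r < 0.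
  by apply: ln_lt0; rewrite r0/=; near: r; exact: nbhs_right_lt.
have rs0 : 0 < r `^ s by rewrite powR_gt0.
have crm : c * r `^ s <= m r by near: r.
have lnm : ln c + s * ln r <= ln (m r).
  rewrite -ln_powR -lnM ?posrE// ler_ln ?posrE ?mulr_gt0//.
  by rewrite (lt_le_trans _ crm)// mulr_gt0.
(* Equivalent to [r <= expR (ln c / e)], a positive threshold. *)
have lnc : e * ln r <= ln c.
  rewrite mulrC -ler_pdivlMr// -[leRHS]expRK ler_ln ?posrE ?expR_gt0//.
  by near: r; apply: nbhs_right_le; exact: expR_gt0.
rewrite ler_ndivrMr// mulrDl; apply: le_trans lnm.
by rewrite addrC lerD2r.
Unshelve. all: by end_near. Qed.

Lemma qA_exponent_lower_bound (R : realType) (d : nat)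
    (mu : probability (borelRd R d) R) (delta s : R) (x : 'rV[R]_d) :
  0 <= delta -> supp mu x -> qA_exponent mu delta s ->
  exists2 c : R, 0 < c &
    \forall r \near 0^'+, c * r `^ s <= fine (mu (eball x r)).
Proof.
move=> delta0 xmu [C1 [C2 [C10 C20 H]]].
pose R0 := Num.min C1 1.
have R00 : 0 < R0 by rewrite lt_min C10/=.
have R01 : R0 <= 1 by rewrite ge_min lexx orbT.
have R0C1 : R0 <= C1 by rewrite ge_min lexx.
have R0d : R0 `^ (1 + delta) <= R0.
  by apply: ge1r_powR; rewrite ?R00// lerDl.
(* Obtained by solving the ratio bound at outer radius [R0] for the measure of the ball of radius
   [r]. *)
exists (fine (mu (eball x R0)) / (C2 * R0 `^ s)).
  by rewrite divr_gt0 ?mulr_gt0 ?powR_gt0// measure_eball_gt0.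
near=> r.
have r0 : 0 < r by [].
have rR0 : r <= R0 `^ (1 + delta).
  by near: r; apply: nbhs_right_le; exact: powR_gt0.
have mr0 : 0 < fine (mu (eball x r)) by exact: measure_eball_gt0.
have : (mu (eball x R0) / mu (eball x r) <= (C2 * (R0 / r) `^ s)%:E)%E.
  apply: le_trans (H _ _ r0 rR0 R0d R0C1).
  by apply: ereal_sup_ubound; exists x.
rewrite -(fineK (measure_eball_fin_num mu x R0)).
rewrite -(fineK (measure_eball_fin_num mu x r)).
rewrite inver gt_eqF// -EFinM lee_fin ler_pdivrMr//.
rewrite powRM ?invr_ge0 ?(ltW R00) ?(ltW r0)//.
rewrite -(powR_inv1 (ltW r0)) -powRrM mulN1r powRN => bound.
rewrite mulrAC ler_pdivrMr ?mulr_gt0 ?powR_gt0//.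
rewrite -ler_pdivlMr ?powR_gt0//; apply: le_trans bound _.
by rewrite /= mulrA mulrC mulrA.
Unshelve. all: by end_near. Qed.

Lemma upper_loc_dim_le_qA_H (R : realType) (d : nat)
    (mu : probability (borelRd R d) R) (delta : R) (x : 'rV[R]_d) :
  0 <= delta -> supp mu x -> (upper_loc_dim mu x <= qA_H mu delta)%E.
Proof.
move=> delta0 xmu; apply: le_ereal_inf_tmp => _ [s sexp <-].
have [c c0 cmu] := qA_exponent_lower_bound delta0 xmu sexp.
exact: limf_esup_ln_ratio_le c0 cmu.
Qed.

Lemma qA_exponent_le (R : realType) (d : nat)
    (mu : probability (borelRd R d) R) (delta1 delta2 s : R) :
  0 <= delta1 -> delta1 <= delta2 ->
  qA_exponent mu delta1 s -> qA_exponent mu delta2 s.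
Proof.
move=> d10 d12 [C1 [C2 [C10 C20 H]]].
exists (Num.min C1 1), C2; split => //; first by rewrite lt_min C10/=.
move=> r r' r0 rr' r'd; rewrite le_min => /andP[r'C1 r'1].
have r'0 : 0 < r' by rewrite (lt_le_trans r0)// (le_trans rr').
apply: H => //; last by apply: ge1r_powR; rewrite ?r'0// lerDl.
by apply: le_trans rr' _; apply: ger_powR; rewrite ?r'0// lerD2l.
Qed.

(** Makes the [lim] in [quasi_assouad_dim] a genuine limit: exponents for a smaller [delta] remain
    exponents for a larger one, so their infimum is monotone. *)
Lemma qA_H_cvg (R : realType) (d : nat) (mu : probability (borelRd R d) R) :
  cvg (qA_H mu delta @[delta --> 0^'+]).
Proof.
apply: nonincreasing_at_right_is_cvge; near=> z => d1 d2.
rewrite !in_itv/= => /andP[d10 _] _ d12.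
apply: ereal_inf_le_tmp; apply: image_subset => s.
exact: qA_exponent_le (ltW d10) d12.
Unshelve. all: by end_near. Qed.

Theorem proposition2p4 (R : realType) (d : nat)
    (mu : probability (borelRd R d) R) :
  (ereal_sup [set upper_loc_dim mu x | x in supp mu] <= quasi_assouad_dim mu)%E.
Proof.
apply: ge_ereal_sup => _ [x xmu <-].
apply: lime_ge; first exact: qA_H_cvg.
by near=> delta; apply: upper_loc_dim_le_qA_H => //; exact: ltW.
Unshelve. all: by end_near. Qed.
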